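(* Let $\Delta$ be a $(d-1)$-dimensional simplicial complex on a finite set $V$ and $L\subseteq\mathbb{R}^V$ a linear subspace such that $(\Delta,L)$ is hereditary. Let $S\in\Delta$ with $s=|S|\ge1$ and let $\mathbf{c}=(c_i)_{i\in S}$ be positive reals. Then $\mathrm{bus}^\mathbf{c}_S:\mathscr{P}^d(\Delta_S,L^\mathbf{c})\to\mathscr{P}^d(\Delta,L)$ is bijective, and its inverse is the linear operator $\mathrm{sub}^\mathbf{c}_S:\mathscr{P}^d(\Delta,L)\to\mathscr{P}^d(\Delta_S,L^\mathbf{c})$ defined by $$\mathrm{sub}^\mathbf{c}_S(f)=f-(-1)^s\sum_{n=s}^\infty\frac{z^n}{n!}\,h_{n-s}(\bar\partial)\,\bar\partial^Sf,$$ where $h_k(\bar\partial)$ is the complete homogeneous symmetric polynomial of degree $k$ in $\bar\partial_i=\partial_i/c_i$ ($i\in S$), $\bar\partial^S=\prod_{i\in S}\bar\partial_i$, and $z=t_0-\sum_{i\in S}c_it_i$. Moreover, $f$ is positive if and only if $\mathrm{sub}^\mathbf{c}_S(f)$ is positive.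
   Context: $D_\mathbf{u}=\sum u_i\partial_i$, $\partial^T=\prod_{i\in T}\partial_i$; lineality space $L_f=\{\mathbf{v}:D_\mathbf{v}f\equiv0\}$; $\Delta_f=\{T:\partial^Tf\not\equiv0\}$. $(\Delta,L)$ is hereditary if for every $T\in\Delta$, $\ell\mapsto(\ell_i)_{i\in T}$ maps $L$ onto $\mathbb{R}^T$. $\mathscr{P}^k(\Delta,L)$ denotes the linear space of homogeneous polynomials $f$ of degree $k$ (in variables indexed by the vertex set of $\Delta$) with $L\subseteq L_f$ and $\Delta_f\subseteq\Delta$. With a new vertex $0\notin V$, the stellar subdivision $\Delta_S$ is the simplicial complex on $V\cup\{0\}$ obtained from $\Delta$ by removing all faces containing $S$ and adding all faces $R\cup\{0\}$ with $S\not\subseteq R$ and $R\cup S\in\Delta$. $L^\mathbf{c}=\{(\ell_0,\ell)\in\mathbb{R}\times\mathbb{R}^V:\ell\in L,\ \ell_0=\sum_{i\in S}c_i\ell_i\}$. $\mathrm{bus}^\mathbf{c}_S(g)=g|_{t_0=\sum_{i\in S}c_it_i}$. A polynomial $f$ with $(\Delta_f,L_f)$ hereditary is positive if $\partial^Ff>0$ for every facet $F$ of $\Delta_f$. *)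

(* Defs.v *)
From HB Require Import structures.
From mathcomp Require Import all_boot all_order all_algebra reals mpoly.

Set Implicit Arguments.
Unset Strict Implicit.
Unset Printing Implicit Defensive.

Import Order.TTheory GRing.Theory Num.Theory.
Local Open Scope ring_scope.

(* The finite vertex set is 'I_n, so polynomials in the variables (t_i)_{i in V}
   are {mpoly R[n]} and R^V is 'rV[R]_n.  The set V + {0} is 'I_n.+1: the new
   vertex 0 is ord0, and i in V is sent to lift ord0 i. *)

Section SimplicialComplex.
Variable n : nat.
Implicit Types (D : {set {set 'I_n}}) (S T F : {set 'I_n}).

Definition simplicial_complex D : Prop :=
  forall T T', T \in D -> T' \subset T -> T' \in D.

(* The dimension of D is cdim D - 1. *)
Definition cdim D : nat := \max_(T in D) #|T|.

Definition facet D F : bool := maxset (fun T => T \in D) F.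

Definition vlift T : {set 'I_n.+1} := [set lift ord0 i | i in T].

Definition stellar D S : {set {set 'I_n.+1}} :=
  [set vlift T | T in [set T : {set 'I_n} in D | ~~ (S \subset T)]] :|:
  [set ord0 |: vlift T | T in [set T : {set 'I_n} | ~~ (S \subset T) & T :|: S \in D]].

End SimplicialComplex.

Section Polynomials.
Variables (R : realFieldType) (n : nat).
Implicit Types (f g : {mpoly R[n]}) (u : 'rV[R]_n) (m : 'X_{1..n}).
Implicit Types (D : {set {set 'I_n}}) (S T F : {set 'I_n}) (c : 'I_n -> R).
Implicit Types (L : {pred 'rV[R]_n}).

Definition Ddir u f : {mpoly R[n]} := \sum_(i < n) u 0 i *: f^`M(i).

(* mesym1 T is the exponent vector of the square-free monomial
   \prod_(i in T) 'X_i. *)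
Definition dset T f : {mpoly R[n]} := f^`M[mesym1 T].

Definition lineality f : {pred 'rV[R]_n} := [pred u | Ddir u f == 0].

Definition complex_of f : {set {set 'I_n}} := [set T | dset T f != 0].

Definition hereditary D L : Prop :=
  forall T, T \in D -> forall x : 'I_n -> R,
    exists2 l, l \in L & forall i, i \in T -> l 0 i = x i.

Definition Pspace (k : nat) D L f : Prop :=
  [/\ f \is k.-homog, {subset L <= lineality f} & complex_of f \subset D].

(* For f homogeneous with (complex_of f, lineality f) hereditary, dset F f is a
   constant polynomial for every facet F. *)
Definition positive f : Prop :=
  hereditary (complex_of f) (lineality f) /\
  forall F, facet (complex_of f) F -> exists2 a : R, 0 < a & dset F f = a%:MP.

Definition Lc L S c : {pred 'rV[R]_n.+1} :=
  [pred l : 'rV[R]_n.+1 | (\row_i l 0 (lift ord0 i) \in L) &&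
            (l 0 ord0 == \sum_(i in S) c i * l 0 (lift ord0 i))].

Definition bus S c (g : {mpoly R[n.+1]}) : {mpoly R[n]} :=
  g \mPo [tuple if unlift ord0 j is Some i then 'X_i
                else \sum_(i in S) c i *: 'X_i | j < n.+1].

Definition plift f : {mpoly R[n.+1]} :=
  f \mPo [tuple 'X_(lift ord0 i) | i < n].

(* \prod_i (\partial_i / c_i) ^ (m i) *)
Definition dbar c m f : {mpoly R[n]} := (\prod_(i < n) (c i)^-1 ^+ m i) *: f^`M[m].

(* h_k(\bar\partial): the sum of all monomials of degree k in the operators
   \partial_i / c_i, i in S. *)
Definition hbar S c (k : nat) f : {mpoly R[n]} :=
  \sum_(m : 'X_{1..n < k.+1} |
        (mdeg m == k) && [forall i, (i \notin S) ==> (m i == 0%N)]) dbar c m f.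

Definition zvar S c : {mpoly R[n.+1]} :=
  'X_ord0 - \sum_(i in S) c i *: 'X_(lift ord0 i).

Definition sub_term S c (k : nat) f : {mpoly R[n.+1]} :=
  (k`!%:R)^-1 *:
    (zvar S c ^+ k * plift (hbar S c (k - #|S|) (dbar c (mesym1 S) f))).

(* The series over k >= #|S| is a finite sum: by sub_term_eq0 below its terms
   with k >= msize f = deg f + 1 are zero. *)
Definition subdiv S c f : {mpoly R[n.+1]} :=
  plift f - (-1) ^+ #|S| *: \sum_(#|S| <= k < msize f) sub_term S c k f.

Lemma mderivm_eq0 m f : (msize f <= mdeg m)%N -> f^`M[m] = 0.
Proof.
move=> le_f_m; apply/mpolyP=> m'; rewrite mcoeff_mderivm mcoeff0.
by rewrite memN_msupp_eq0 ?mul0rn // msize_mdeg_ge // mdegD (leq_trans le_f_m) ?leq_addr.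
Qed.

Lemma sub_term_eq0 S c (k : nat) f :
  (#|S| <= k)%N -> (msize f <= k)%N -> sub_term S c k f = 0.
Proof.
move=> le_S_k le_f_k; rewrite /sub_term /hbar big1 ?[plift 0]raddf0 ?mulr0 ?scaler0 //.
move=> m /andP[/eqP deg_m _]; rewrite /dbar linearZ /= -mderivmDm.
by rewrite mderivm_eq0 ?scaler0 // mdegD mdeg_mesym1 deg_m subnKC.
Qed.

Lemma Pspace_linear (k : nat) D L (a : R) f g :
  Pspace k D L f -> Pspace k D L g -> Pspace k D L (a *: f + g).
Proof.
case=> hf Lf Df [hg Lg Dg]; split; first by rewrite rpredD ?rpredZ.
- move=> u Lu; have /eqP fu := Lf u Lu; have /eqP gu := Lg u Lu.
  rewrite inE /= /Ddir; under eq_bigr => i _ do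
    rewrite linearD /= linearZ /= scalerDr scalerA mulrC -scalerA.
  by rewrite big_split /= -scaler_sumr -!/(Ddir u _) fu gu scaler0 addr0.
- apply/subsetP=> T; rewrite inE => fgT; apply: contraNT fgT => DT.
  have /eqP fT : dset T f == 0.
    by apply: contraNT DT => fT; apply: (subsetP Df); rewrite inE.
  have /eqP gT : dset T g == 0.
    by apply: contraNT DT => gT; apply: (subsetP Dg); rewrite inE.
  by rewrite /dset linearD /= linearZ /= -!/(dset T _) fT gT scaler0 addr0.
Qed.

End Polynomials.

(* Main.v *)
Require Import Defs.
From HB Require Import structures.
From mathcomp Require Import all_boot all_order all_algebra reals mpoly.

Set Implicit Arguments.
Unset Strict Implicit.
Unset Printing Implicit Defensive.

Import Order.TTheory GRing.Theory Num.Theory.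
Local Open Scope ring_scope.

(** Expand a polynomial [g] in the variables [t_0, (t_i)] around [z = 0]: its
Taylor coefficients [tay k g = bus (\partial_0^k g)] determine it, [\partial_0]
acts on them as the shift [E] and [\partial_i], for [i] in [S], as
[\partial_i - c_i E]. All claims are read off these coefficients. The relation
[\partial^S (sub f) = 0] says that, with [x_i = \partial_i / c_i], the operator
[\prod_i (x_i - E)] maps the sequence [(h_{k-s}(x))_k] to [((-1)^s, 0, 0, ...)].
For the injectivity of [bus]: if [g] lies in [P^d(\Delta_S, L^c)] and
[0 < k < s], then [tay k g] has degree [d - k] and is supported on the star of
[S]; by heredity a nonzero such polynomial would have a face of size [d - k]
disjoint from [S], too large to be joined with [S]. For [k >= s] the relation
[\partial^S g = 0] expresses [tay k g] through lower coefficients. Finally, a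
polynomial with hereditary complex is positive iff its square-free coefficients
of top degree are nonnegative, and those of [sub f] are those of [f] up to
positive factors. *)

(** * Chain rule and homogeneity under substitution and differentiation *)

Lemma mpoly_subalg_ind (R : nzRingType) (n : nat) (P : {mpoly R[n]} -> Prop) :
  P 0 -> P 1 -> (forall i, P 'X_i) ->
  (forall a p q, P p -> P q -> P (a *: p + q)) ->
  (forall p q, P p -> P q -> P (p * q)) -> forall p, P p.
Proof.
move=> P0 P1 PX PD PM; elim/mpolyind=> // a m p _ _ Pp; apply: PD => //.
rewrite mpolyXE_id; apply: (big_ind P) => // i _.
by elim: (m i) => [|k IHk]; rewrite ?expr0 // exprS; apply: PM.
Qed.

Lemma mderiv_comp_mpoly (R : comNzRingType) (n k : nat)
    (lq : n.-tuple {mpoly R[k]}) (i : 'I_k) (p : {mpoly R[n]}) :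
  (p \mPo lq)^`M(i) =
    \sum_(j < n) (p^`M(j) \mPo lq) * (tnth lq j)^`M(i).
Proof.
elim/mpoly_subalg_ind: p => [||j|a p q IHp IHq|p q IHp IHq].
- by rewrite comp_mpoly0 mderiv0 big1 // => j _; rewrite mderiv0 comp_mpoly0 mul0r.
- by rewrite comp_mpoly1 mderivC big1 // => j _; rewrite mderivC comp_mpoly0 mul0r.
- rewrite comp_mpolyXU (bigD1 j) //= big1 => [|j' /negbTE jj'].
    rewrite mderivX mnm1E eqxx scale1r (_ : U_(j) - U_(j) = 0)%MM
      ?mpolyX0 ?comp_mpoly1 ?mul1r ?addr0.
      by rewrite (tnth_nth 0).
    by apply/mnmP=> l; rewrite mnmBE subnn mnm0E.
  by rewrite mderivX mnm1E eq_sym jj' scale0r comp_mpoly0 mul0r.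
- rewrite comp_mpolyD comp_mpolyZ mderivD mderivZ IHp IHq scaler_sumr -big_split.
  apply: eq_bigr => j _ /=.
  by rewrite mderivD mderivZ comp_mpolyD comp_mpolyZ mulrDl scalerAl.
rewrite rmorphM /= mderivM IHp IHq mulr_suml mulr_sumr -big_split /=.
apply: eq_bigr => j _; rewrite mderivM comp_mpolyD !rmorphM /= mulrDl.
by rewrite mulrAC -!mulrA.
Qed.

Lemma dhomog_comp_mpoly (R : comNzRingType) (n k d : nat)
    (lq : n.-tuple {mpoly R[k]}) (p : {mpoly R[n]}) :
  (forall j, tnth lq j \is 1.-homog) -> p \is d.-homog ->
  p \mPo lq \is d.-homog.
Proof.
move=> hlq /dhomogP hp; rewrite comp_mpolyEX big_seq rpred_sum // => m pm.
have <- : mdeg m = d := hp m pm; rewrite rpredZ // comp_mpolyX mdegE.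
apply: (big_ind2 (fun p e => p \is e.-homog)) => [||j _].
- exact: dhomog1.
- by move=> ? ? ? ? h1 h2; apply: dhomogM.
- by have := dhomogMn (m j) (hlq j); rewrite mul1n.
Qed.

Lemma dhomog_mderivm (R : nzRingType) (n d : nat) (m : 'X_{1..n}) (p : {mpoly R[n]}) :
  p \is (d + mdeg m)%N.-homog -> p^`M[m] \is d.-homog.
Proof.
move=> hp; apply/dhomogP=> m' /=; rewrite mcoeff_msupp mcoeff_mderivm => nz.
have pm : (m + m')%MM \in msupp p.
  by rewrite mcoeff_msupp; apply: contraNneq nz => ->; rewrite mul0rn.
have h : mdeg (m + m')%MM = (d + mdeg m)%N := dhomog_mf hp pm.
by apply/eqP; rewrite -(eqn_add2r (mdeg m)) -h mdegD addnC.
Qed.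

Lemma dhomog_mderivm_eq0 (R : nzRingType) (n d : nat) (m : 'X_{1..n})
    (p : {mpoly R[n]}) :
  p \is d.-homog -> (d < mdeg m)%N -> p^`M[m] = 0.
Proof.
move=> hp lt_dm; apply/mpolyP=> m'; rewrite mcoeff_mderivm mcoeff0.
rewrite (dhomog_nemf_coeff hp) ?mul0rn // gtn_eqF //.
by rewrite [X in (_ < X)%N]mdegD (leq_trans lt_dm) ?leq_addr.
Qed.

(** * Square-free derivatives *)

Section Derivatives.
Variables (R : realFieldType) (n : nat).
Implicit Types (f : {mpoly R[n]}) (S T F : {set 'I_n}).

Lemma dset0 f : dset set0 f = f.
Proof. by rewrite /dset mesym1_set0 mderivm0m. Qed.

Lemma dset1 i f : dset [set i] f = f^`M(i).
Proof. by rewrite /dset mesym1_set1 mderivmU1m. Qed.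

Lemma dset_disjointU S T f :
  [disjoint S & T] -> dset (S :|: T) f = dset T (dset S f).
Proof.
move=> dST; rewrite /dset -mderivmDm; congr (_^`M[_]).
apply/mnmP=> i; rewrite mnmDE !mnmE inE.
case iS: (i \in S); case iT: (i \in T) => //.
by have /pred0P/(_ i) := dST; rewrite /= iS iT.
Qed.

Lemma dsetU1 i T f : i \notin T -> dset (i |: T) f = (dset T f)^`M(i).
Proof.
move=> iT; rewrite setUC dset_disjointU ?dset1 //.
by rewrite disjoint_sym disjoints1.
Qed.

Lemma mderivm_comm (m1 m2 : 'X_{1..n}) f : f^`M[m1]^`M[m2] = f^`M[m2]^`M[m1].
Proof. by rewrite -!mderivmDm addmC. Qed.

Lemma dset_comm S T f : dset S (dset T f) = dset T (dset S f).
Proof. exact: mderivm_comm. Qed.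

Lemma dset_mderiv i T f : dset T f^`M(i) = (dset T f)^`M(i).
Proof. by rewrite -!dset1 dset_comm. Qed.

Lemma dset_split S T f : dset T f = dset (T :&: S) (dset (T :\: S) f).
Proof.
rewrite -{1}(setID T S) dset_disjointU 1?dset_comm // -setI_eq0.
by apply/eqP/setP=> i; rewrite !inE; case: (i \in S); rewrite ?andbF.
Qed.

Lemma dset_sub S T f : S \subset T -> dset T f = dset (T :\: S) (dset S f).
Proof. by move=> sST; rewrite dset_comm (dset_split S) (setIidPr sST). Qed.

Lemma dset_dhomog d T f : f \is d.-homog -> dset T f \is (d - #|T|).-homog.
Proof.
move=> hf; have [le_Td|lt_dT] := leqP #|T| d.
  by apply: dhomog_mderivm; rewrite mdeg_mesym1 subnK.
by rewrite /dset (dhomog_mderivm_eq0 hf) ?dhomog0 ?mdeg_mesym1.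
Qed.
End Derivatives.

(** * Faces, facets and positivity of homogeneous polynomials *)

Section Faces.
Variables (R : realFieldType) (n : nat).
Implicit Types (f : {mpoly R[n]}) (W S T F : {set 'I_n}) (u : 'rV[R]_n).

Lemma dhomog0_const f : f \is 0.-homog -> f = (f@_0)%:MP.
Proof.
move=> hf; apply/mpolyP=> m; rewrite mcoeffC.
have [->|m0] := eqVneq m 0%MM; first by rewrite mulr1.
by rewrite mulr0 (dhomog_nemf_coeff hf) //= mdeg_eq0.
Qed.

Lemma dhomog_mderiv_eq0 d f :
  f \is d.+1.-homog -> (forall i, f^`M(i) = 0) -> f = 0.
Proof.
move=> hf f'0; apply/mpolyP=> m; rewrite mcoeff0.
have [m0|/existsP[i mi]] := boolP [forall i, m i == 0%N].
  rewrite (dhomog_nemf_coeff hf) //= (_ : m = 0%MM) ?mdeg0 //.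
  by apply/mnmP=> i; rewrite mnm0E; apply/eqP/(forallP m0).
have /eqP := congr1 (mcoeff (m - U_(i))%MM) (f'0 i).
rewrite mcoeff_mderiv mcoeff0 submK ?lep1mP // mulrn_eq0 /=.
by move/eqP.
Qed.

Lemma dset_top d F f :
  f \is d.-homog -> #|F| = d -> dset F f = (f@_(mesym1 F))%:MP.
Proof.
move=> hf dF; have := dset_dhomog F hf; rewrite dF subnn.
move/dhomog0_const->; rewrite mcoeff_mderivm addm0 big1 // => i _.
by rewrite ffactnn mnmE; case: (i \in F).
Qed.

Lemma dset_gt d T f : f \is d.-homog -> (d < #|T|)%N -> dset T f = 0.
Proof. by move=> hf lt_dT; apply: dhomog_mderivm_eq0 hf _; rewrite mdeg_mesym1. Qed.

Lemma Ddir_dset u T f : Ddir u (dset T f) = dset T (Ddir u f).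
Proof.
rewrite /Ddir /dset linear_sum; apply: eq_bigr => i _ /=.
by rewrite mderivmZ -!mderivmU1m mderivm_comm.
Qed.

(* If every derivative of [dset F f] off [W] vanished, so would those along [W]:
   subtract a lineality vector that restricts to a unit vector on [W]. *)
Lemma face_extend e W F f :
  f \is e.-homog -> F \subset W ->
  (forall x : 'I_n -> R,
    exists2 l, l \in lineality f & forall i, i \in W -> l 0 i = x i) ->
  dset F f != 0 -> (#|F| < e)%N ->
  exists2 i, i \notin W & dset (i |: F) f != 0.
Proof.
move=> hf sFW hW fF ltFe.
have hF : dset F f \is (e - #|F|).-1.+1.-homog.
  by rewrite prednK ?subn_gt0 //; apply: dset_dhomog.
have [/existsP[i /andP[iW fi]]|/existsPn noi] :=
  boolP [exists i, (i \notin W) && ((dset F f)^`M(i) != 0)].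
  by exists i => //; rewrite dsetU1 //; apply: contraNN iW; apply: subsetP.
have fW i : i \notin W -> (dset F f)^`M(i) = 0.
  by move=> iW; apply/eqP; have := noi i; rewrite iW /= negbK.
case/eqP: fF; apply: dhomog_mderiv_eq0 hF _ => i.
have [iW|/fW//] := boolP (i \in W).
have [l /eqP fl lE] := hW (fun j => (j == i)%:R).
have := Ddir_dset l F f; rewrite fl [dset _ 0]linear0 /Ddir (bigD1 i) //=.
rewrite lE // eqxx scale1r big1 ?addr0 // => j ji.
have [jW|/fW->] := boolP (j \in W); last by rewrite scaler0.
by rewrite lE // (negbTE ji) scale0r.
Qed.

(** A face of size below [d] is enlarged by [face_extend] with [W = F], where heredity at [F]
    supplies the lineality vectors; sets larger than [d] are excluded by degree. *)
Lemma facet_card d f F :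
  f \is d.-homog -> hereditary (complex_of f) (lineality f) ->
  facet (complex_of f) F = (F \in complex_of f) && (#|F| == d).
Proof.
move=> hf her; apply/idP/andP=> [/maxsetP[fF maxF]|[fF /eqP dF]].
  split=> //; rewrite inE in fF.
  have [ltFd|ltdF|/eqP//] := ltngtP #|F| d; last first.
    by rewrite (dset_gt hf ltdF) eqxx in fF.
  have [|i iF fi] := face_extend hf (subxx F) _ fF ltFd.
    by move=> x; apply: her; rewrite inE.
  have fiF : i |: F \in complex_of f by rewrite inE.
  by move: iF; rewrite -(maxF _ fiF (subsetU1 i F)) setU11.
apply/maxsetP; split=> // T; rewrite inE => fT sFT.
apply/esym/eqP; rewrite eqEcard sFT dF leqNgt.
by apply: contraNN fT => /(dset_gt hf) ->.
Qed.

(** By [facet_card] the facets are exactly the sets of size [d] with nonzero coefficient. Allowing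
    the value zero turns positivity into a condition on all such sets, which no longer mentions the
    complex. *)
Lemma positiveP d f :
  f \is d.-homog -> hereditary (complex_of f) (lineality f) ->
  positive f <-> (forall F, #|F| = d -> 0 <= f@_(mesym1 F)).
Proof.
move=> hf her; split=> [[_ pos] F dF|pos].
  have [->//|nz] := eqVneq (f@_(mesym1 F)) 0.
  have [|a a0] := pos F.
    by rewrite (facet_card _ hf her) inE (dset_top hf dF) dF mpolyC_eq0 nz eqxx.
  by rewrite (dset_top hf dF) => /eqP; rewrite mpolyC_eq => /eqP ->; apply: ltW.
split=> // F; rewrite (facet_card _ hf her) inE => /andP[fF /eqP dF].
move: fF; rewrite (dset_top hf dF) mpolyC_eq0 => nz.
by exists f@_(mesym1 F) => //; rewrite lt_neqAle eq_sym nz pos.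
Qed.

Lemma hereditary_sub (D D' : {set {set 'I_n}}) (L L' : {pred 'rV[R]_n}) :
  D' \subset D -> {subset L <= L'} -> hereditary D L -> hereditary D' L'.
Proof.
move=> sD sL her T /(subsetP sD) TD x.
by have [l /sL lL' lx] := her T TD x; exists l.
Qed.

(* A nonzero [f] supported on the star of [S] has faces of full size [e] that
   avoid [S], and these can be joined with [S]. *)
Lemma star_dhomog_eq0 (D : {set {set 'I_n}}) (L : {pred 'rV[R]_n}) S e f :
  hereditary D L -> f \is e.-homog -> {subset L <= lineality f} ->
  (forall T, T \in complex_of f -> T :|: S \in D) ->
  (cdim D < e + #|S|)%N -> f = 0.
Proof.
move=> her hf Lf fS ltD; apply: contraTeq ltD => f0; rewrite -leqNgt.
have [F [fF dFS dF]] : exists F, [/\ dset F f != 0, [disjoint F & S] & #|F| = e].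
  suff : forall j, (j <= e)%N ->
      exists F, [/\ dset F f != 0, [disjoint F & S] & #|F| = j] by apply.
  elim=> [|j IHj] ltje.
    by exists set0; rewrite dset0 -setI_eq0 set0I cards0 eqxx.
  have [F [fF dFS dF]] := IHj (ltnW ltje).
  have [||i iW fi] := face_extend hf (subsetUl F S) _ fF.
  - move=> x; have [|l /Lf lf lx] := her (F :|: S) _ x; last by exists l.
    by apply: fS; rewrite inE.
  - by rewrite dF.
  move: iW; rewrite inE => /norP[iF iS]; exists (i |: F); split=> //.
    by rewrite -setI_eq0 setIUl (disjoint_setI0 dFS) setU0 setI_eq0 disjoints1.
  by rewrite cardsU1 iF dF.
have := fS F; rewrite inE => /(_ fF) FS; rewrite -dF.
have <- : #|F :|: S| = (#|F| + #|S|)%N.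
  by rewrite cardsU (disjoint_setI0 dFS) cards0 subn0.
exact: (leq_bigmax_cond (F := fun T : {set 'I_n} => #|T|)).
Qed.
End Faces.

(** * Taylor expansion in powers of [z] *)

Section Taylor.
Variables (R : realFieldType) (n : nat) (S : {set 'I_n}) (c : 'I_n -> R).
Implicit Types (f h : {mpoly R[n]}) (g : {mpoly R[n.+1]}) (T A : {set 'I_n}).

Let bus_tuple : n.+1.-tuple {mpoly R[n]} :=
  [tuple if unlift ord0 j is Some i then 'X_i
         else \sum_(i in S) c i *: 'X_i | j < n.+1].
Let plift_tuple : n.-tuple {mpoly R[n.+1]} := [tuple 'X_(lift ord0 i) | i < n].

HB.instance Definition _ := GRing.LRMorphism.copy (bus S c) (comp_mpoly bus_tuple).
HB.instance Definition _ :=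
  GRing.LRMorphism.copy (@plift R n) (comp_mpoly plift_tuple).

(** Extending [c] by zero off [S] lets one formula cover the derivatives inside and outside [S]. *)
Definition sc i : R := if i \in S then c i else 0.

Lemma mderivXU (m : nat) (i j : 'I_m) :
  ('X_i : {mpoly R[m]})^`M(j) = (i == j)%:R.
Proof.
rewrite mderivX mnm1E; case: eqP => [->|_]; last by rewrite scale0r.
by rewrite scale1r -mpolyX0; congr 'X_[_]; apply/mnmP=> l; rewrite mnmBE subnn mnm0E.
Qed.

Lemma bus_X0 : bus S c 'X_ord0 = \sum_(i in S) c i *: 'X_i.
Proof. by rewrite /bus comp_mpolyXU -tnth_nth tnth_mktuple unlift_none. Qed.

Lemma bus_Xlift i : bus S c 'X_(lift ord0 i) = 'X_i.
Proof. by rewrite /bus comp_mpolyXU -tnth_nth tnth_mktuple liftK. Qed.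

Lemma plift_X i : plift ('X_i : {mpoly R[n]}) = 'X_(lift ord0 i).
Proof. by rewrite /plift comp_mpolyXU -tnth_nth tnth_mktuple. Qed.

Lemma bus_plift f : bus S c (plift f) = f.
Proof.
elim/mpoly_subalg_ind: f => [||i|a p q IHp IHq|p q IHp IHq].
- by rewrite !linear0.
- by rewrite !rmorph1.
- by rewrite plift_X bus_Xlift.
- by rewrite !linearP /= IHp IHq.
- by rewrite !rmorphM /= IHp IHq.
Qed.

Lemma bus_zvar : bus S c (zvar S c) = 0.
Proof.
rewrite raddfB /= bus_X0 (raddf_sum (bus S c)) /=.
apply/eqP; rewrite subr_eq0; apply/eqP.
by apply: eq_bigr => i _; rewrite linearZ /= bus_Xlift.
Qed.

Lemma bus_comp : exists lq : n.+1.-tuple {mpoly R[n]},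
  [/\ bus S c =1 comp_mpoly lq, tnth lq ord0 = \sum_(i in S) c i *: 'X_i &
      forall j, tnth lq (lift ord0 j) = 'X_j].
Proof.
exists bus_tuple; split=> // [|j]; first by rewrite tnth_mktuple unlift_none.
by rewrite tnth_mktuple liftK.
Qed.

Lemma mderiv_bus i g :
  (bus S c g)^`M(i) = bus S c g^`M(lift ord0 i) + sc i *: bus S c g^`M(ord0).
Proof.
have [lq [busE lq0 lqS]] := bus_comp.
rewrite !busE mderiv_comp_mpoly big_ord_recl addrC; congr (_ + _).
  rewrite (bigD1 i) //= big1 => [|j ji].
    by rewrite lqS mderivXU eqxx mulr1 addr0.
  by rewrite lqS mderivXU (negbTE ji) mulr0.
rewrite lq0 (raddf_sum (mderiv i)) -mulr_algr; congr (_ * _).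
under eq_bigr => j _ do rewrite /= mderivZ mderivXU.
rewrite /sc; case: ifP => iS.
  rewrite (bigD1 i) //= big1 ?eqxx ?addr0 // => j /andP[_ /negbTE->].
  by rewrite scaler0.
rewrite scale0r big1 // => j jS; case: eqP => [ji|_]; last by rewrite scaler0.
by rewrite -ji jS in iS.
Qed.

Lemma mderiv_plift i f : (plift f)^`M(lift ord0 i) = plift f^`M(i).
Proof.
rewrite /plift mderiv_comp_mpoly (bigD1 i) //= big1 => [|j ji].
  by rewrite tnth_mktuple mderivXU eqxx mulr1 addr0.
by rewrite tnth_mktuple mderivXU (inj_eq lift_inj) (negbTE ji) mulr0.
Qed.

Lemma mderiv0_plift f : (plift f)^`M(ord0) = 0.
Proof.
rewrite /plift mderiv_comp_mpoly big1 // => j _.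
by rewrite tnth_mktuple mderivXU mulr0.
Qed.

(** In characteristic zero, a vanishing derivative in [t_0] means that no monomial of [g] contains
    [t_0]; on the remaining variables [bus] and [plift] are inverse renamings. *)
Lemma plift_bus g : g^`M(ord0) = 0 -> plift (bus S c g) = g.
Proof.
move=> g0; rewrite [RHS]mpolyE {1}[g]mpolyE.
rewrite (raddf_sum (bus S c)) (raddf_sum (@plift R n)) /= big_seq [RHS]big_seq.
apply: eq_bigr => m gm /=; rewrite !linearZ /=; congr (_ *: _).
have m0 : m ord0 = 0%N.
  apply: contraTeq gm => m0; rewrite mcoeff_msupp negbK.
  have /eqP := congr1 (mcoeff (m - U_(ord0))%MM) g0.
  by rewrite mcoeff_mderiv mcoeff0 submK ?lep1mP // mulrn_eq0.
rewrite mpolyXE_id big_ord_recl m0 expr0 mul1r.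
rewrite (rmorph_prod (bus S c)) (rmorph_prod (@plift R n)); apply: eq_bigr => i _.
by rewrite !rmorphXn /= bus_Xlift plift_X.
Qed.

(** This is [k!] times the coefficient of [z^k]; without dividing by [k!], the derivative in [t_0]
    is exactly the shift of the sequence. *)
Definition tay k g := bus S c g^`M(ord0, k).

Lemma tay_is_linear k : linear (tay k).
Proof. by move=> a p q; rewrite /tay !linearP. Qed.

HB.instance Definition _ k := GRing.isLinear.Build R {mpoly R[n.+1]} {mpoly R[n]} _
  (tay k) (tay_is_linear k).

Lemma tay0 g : tay 0 g = bus S c g.
Proof. by rewrite /tay mderivn0. Qed.

Lemma tay_mderiv0 k g : tay k g^`M(ord0) = tay k.+1 g.
Proof. by rewrite /tay mderivSn. Qed.

Lemma tay_mderiv k i g :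
  tay k g^`M(lift ord0 i) = (tay k g)^`M(i) - sc i *: tay k.+1 g.
Proof.
by rewrite /tay mderiv_bus mderivnS -[_^`M(lift _ _)]mderivmU1m mderivm_comm
  mderivmU1m addrK.
Qed.

(** Once the derivative of order [j + 1] in [t_0] vanishes, the one of order [j] is free of [t_0],
    hence is the lift of its image under [bus], which is [tay j g = 0]. *)
Lemma tay_inj g : (forall k, tay k g = 0) -> g = 0.
Proof.
move=> g0; rewrite -(mderivn0 ord0 g).
(* Descending induction: the order [msize g - k] falls from [msize g], where the derivative vanishes
   by degree, to 0 by truncated subtraction. *)
have [k lekg] : exists k, (msize g - k)%N = 0%N by exists (msize g); rewrite subnn.
rewrite -[0%N in LHS]lekg; elim: k {lekg} => [|k IHk].
  by rewrite subn0 mderivm_eq0 // mdegMn mdeg1 mul1n.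
have [lekg|ltkg] := leqP (msize g) k.
  move: IHk; rewrite (eqP (lekg : (_ - _)%N == 0%N)).
  by rewrite (eqP (leqW lekg : (_ - _)%N == 0%N)).
have := g0 (msize g - k.+1)%N; rewrite /tay => gk.
rewrite -[LHS]plift_bus ?gk ?linear0 //.
by rewrite -mderivnS subnSK.
Qed.

Lemma tay_plift k f : tay k (plift f) = if k == 0%N then f else 0.
Proof.
case: k => [|k]; first by rewrite tay0 bus_plift.
by rewrite -tay_mderiv0 mderiv0_plift linear0.
Qed.

Lemma mderiv0_zvar : (zvar S c)^`M(ord0) = 1.
Proof.
rewrite mderivB mderivXU eqxx (raddf_sum (mderiv ord0)) big1 ?subr0 // => i _ /=.
by rewrite mderivZ mderivXU scaler0.
Qed.

Lemma mderiv0_zvarX k h :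
  (zvar S c ^+ k.+1 * plift h)^`M(ord0) = k.+1%:R *: (zvar S c ^+ k * plift h).
Proof.
rewrite mderivM mderiv0_plift mulr0 addr0 scalerAl; congr (_ * _).
elim: k => [|k IHk]; first by rewrite expr1 mderiv0_zvar expr0 scale1r.
rewrite exprS mderivM mderiv0_zvar mul1r IHk -scalerAr -exprS.
by rewrite -[k.+2%:R]natr1 scalerDl scale1r addrC.
Qed.

Lemma tay_zvarX k m h :
  tay k (zvar S c ^+ m * plift h) = if k == m then m`!%:R *: h else 0.
Proof.
elim: m k => [|m IHm] [|k]; rewrite ?expr0 ?mul1r ?tay_plift ?scale1r //.
  by rewrite tay0 exprS !rmorphM /= bus_zvar !mul0r.
rewrite -tay_mderiv0 mderiv0_zvarX linearZ /= IHm eqSS.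
by case: eqP; rewrite ?scaler0 // scalerA -natrM factS.
Qed.

Lemma tay_sub_term k m f :
  tay k (sub_term S c m f) =
    if k == m then hbar S c (m - #|S|) (dbar c (mesym1 S) f) else 0.
Proof.
rewrite /sub_term linearZ /= tay_zvarX; case: eqP; rewrite ?scaler0 // => _.
by rewrite scalerA mulVf ?scale1r // pnatr_eq0 -lt0n fact_gt0.
Qed.

End Taylor.

(** * Complete homogeneous symmetric operators and the Taylor coefficients of [subdiv] *)

Section CompleteSymmetric.
Variables (R : realFieldType) (n : nat) (c : 'I_n -> R).
Implicit Types (f : {mpoly R[n]}) (S T A : {set 'I_n}) (m : 'X_{1..n}).

Lemma dbarD m1 m2 f : dbar c (m1 + m2) f = dbar c m2 (dbar c m1 f).
Proof.
rewrite /dbar mderivmDm mderivmZ scalerA -big_split /=; congr (_ *: _).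
by apply: eq_bigr => i _; rewrite mnmDE addnC exprD.
Qed.

Lemma dbar0m f : dbar c 0 f = f.
Proof.
by rewrite /dbar mderivm0m big1 ?scale1r // => i _; rewrite mnm0E expr0.
Qed.

Lemma dbarU i f : dbar c U_(i) f = (c i)^-1 *: f^`M(i).
Proof.
rewrite /dbar mderivmU1m (bigD1 i) //= mnm1E eqxx expr1 big1 ?mulr1 // => j ji.
by rewrite mnm1E eq_sym (negbTE ji) expr0.
Qed.

Lemma dbar_mesym1 S f :
  dbar c (mesym1 S) f = (\prod_(i in S) (c i)^-1) *: dset S f.
Proof.
rewrite /dbar -/(dset S f); congr (_ *: _); rewrite [RHS]big_mkcond.
by apply: eq_bigr => i _; rewrite mnmE; case: (i \in S).
Qed.

Lemma mderivm_dbar m m' f : (dbar c m f)^`M[m'] = dbar c m f^`M[m'].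
Proof. by rewrite /dbar mderivmZ mderivm_comm. Qed.

Lemma mderivm_hbar S k m f : (hbar S c k f)^`M[m] = hbar S c k f^`M[m].
Proof.
rewrite /hbar linear_sum; apply: eq_bigr => m' _ /=; exact: mderivm_dbar.
Qed.

Lemma hbar_is_linear S k : linear (hbar S c k).
Proof.
move=> a p q; rewrite /hbar scaler_sumr -big_split; apply: eq_bigr => m _ /=.
by rewrite /dbar linearP scalerDr !scalerA mulrC.
Qed.

HB.instance Definition _ S k := GRing.isLinear.Build R {mpoly R[n]} {mpoly R[n]} _
  (hbar S c k) (hbar_is_linear S k).

Lemma Ddir_hbar u S k f : Ddir u (hbar S c k f) = hbar S c k (Ddir u f).
Proof.
rewrite /Ddir linear_sum; apply: eq_bigr => i _ /=.
by rewrite linearZ /= -!mderivmU1m mderivm_hbar.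
Qed.

Lemma hbar0 S f : hbar S c 0 f = f.
Proof.
rewrite /hbar (bigD1 bm0) /=; last first.
  by rewrite mdeg0; apply/forallP=> i; rewrite mnm0E implybT.
rewrite dbar0m big1 ?addr0 // => m /andP[/andP[m0 _] /eqP[]].
by apply/val_inj/eqP; rewrite /= -mdeg_eq0.
Qed.

Lemma hbar_set0 k f : hbar set0 c k.+1 f = 0.
Proof.
rewrite /hbar big1 // => m /andP[/eqP dm /forallP m0]; move: dm.
rewrite (_ : bmnm m = 0%MM) ?mdeg0 //; apply/mnmP=> i; rewrite mnm0E.
by apply/eqP; have := m0 i; rewrite inE.
Qed.

(** The recursion for complete homogeneous polynomials: split the monomials according to whether the
    variable of [j] occurs, and in those where it does, divide by it once. *)
Lemma hbarU1 j A k f : j \notin A ->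
  hbar (j |: A) c k.+1 f =
    hbar A c k.+1 f + (c j)^-1 *: (hbar (j |: A) c k f)^`M(j).
Proof.
move=> jA; rewrite /hbar (bigID (fun m : 'X_{1..n < k.+2} => m j == 0%N)) /=.
congr (_ + _).
  apply: eq_bigl => m; rewrite -andbA; congr (_ && _).
  apply/andP/forallP=> [[/forallP m0 mj] i|m0].
    apply/implyP=> iA; have [->//|ij] := eqVneq i j.
    by have := m0 i; rewrite !inE (negbTE ij) iA.
  split; last by have := m0 j; rewrite jA.
  by apply/forallP=> i; apply/implyP; rewrite !inE => /norP[_ iA];
    have := m0 i; rewrite iA.
(* Multiplication and division by the variable of [j]. The default [bm0] never matters: [h] raises
   the degree and its bound together, and [h'] is used only where [m j] is nonzero. *)
pose h (m : 'X_{1..n < k.+1}) : 'X_{1..n < k.+2} := insubd bm0 (m + U_(j))%MM.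
pose h' (m : 'X_{1..n < k.+2}) : 'X_{1..n < k.+1} := insubd bm0 (m - U_(j))%MM.
have hE (m : 'X_{1..n < k.+1}) : h m = (m + U_(j))%MM :> 'X_{1..n}.
  by rewrite /h val_insubd mdegD mdeg1 addn1 ltnS bmdeg.
have h'E (m : 'X_{1..n < k.+2}) : m j != 0%N -> h' m = (m - U_(j))%MM :> 'X_{1..n}.
  move=> mj; have := bmdeg m; rewrite /h' val_insubd /=.
  by rewrite -{1}(submK (_ : U_(j) <= m)%MM) ?lep1mP // mdegD mdeg1 addn1 ltnS => ->.
rewrite (reindex_onto h h') /=; last first.
  by move=> m /andP[_ mj]; apply/val_inj; rewrite /= hE h'E // submK // lep1mP.
rewrite (linear_sum (mderiv j)) scaler_sumr; apply: eq_big => [m|m _]; last first.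
  by rewrite hE dbarD dbarU.
have hm : h m j != 0%N by rewrite hE mnmDE mnm1E eqxx addn1.
have -> : h' (h m) == m by rewrite bmeqP h'E // hE addmK.
rewrite hm hE !andbT mdegD mdeg1 addn1 eqSS; congr (_ && _).
apply: eq_forallb => i; rewrite mnmDE mnm1E !inE.
by have [|] := eqVneq j i; rewrite ?addn0.
Qed.

Lemma tay_subdiv S k f :
  tay S c k (subdiv S c f) =
    (if k == 0%N then f else 0) -
    (-1) ^+ #|S| *:
      (if (#|S| <= k)%N then hbar S c (k - #|S|) (dbar c (mesym1 S) f) else 0).
Proof.
rewrite /subdiv linearB /= tay_plift linearZ /= (linear_sum (tay S c k)) /=.
congr (_ - _ *: _).
under eq_bigr => l _ do rewrite tay_sub_term.
have [leSk|ltkS] := leqP #|S| k; last first.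
  rewrite big_nat big1 // => m /andP[leSm _].
  by rewrite (ltn_eqF (leq_trans ltkS leSm)).
(* Orders from [msize f] on are cut off from the finite sum, but there the [hbar] term is zero by
   degree. *)
have [lefk|ltkf] := leqP (msize f) k.
  rewrite big_nat big1 => [|m /andP[_ ltmf]]; last first.
    by rewrite gtn_eqF // (leq_trans ltmf).
  by have := tay_sub_term S c k k f; rewrite eqxx sub_term_eq0 // linear0.
rewrite (bigD1_seq k) ?iota_uniq ?mem_index_iota ?leSk //= eqxx.
by rewrite big1 ?addr0 // => m mk; rewrite eq_sym (negbTE mk).
Qed.

End CompleteSymmetric.

(** * Lifting vertex sets to the enlarged vertex set *)

Lemma finset_ind (T : finType) (P : {set T} -> Prop) :
  P set0 -> (forall i (A : {set T}), i \notin A -> P A -> P (i |: A)) -> forall A, P A.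
Proof.
move=> P0 PU A; elim: {A}#|A| {-2}A (erefl #|A|) => [|k IHk] A.
  by move/eqP; rewrite cards_eq0 => /eqP->.
move=> dA; have [i iA] : exists i, i \in A by apply/card_gt0P; rewrite dA.
rewrite -(setD1K iA); apply: PU; first by rewrite setD11.
by apply: IHk; move: dA; rewrite (cardsD1 i A) iA => -[].
Qed.

Section Lifts.
Variable n : nat.
Implicit Types T A : {set 'I_n}.

Lemma mem_vlift i T : (lift ord0 i \in vlift T) = (i \in T).
Proof. by rewrite mem_imset //; apply: lift_inj. Qed.

Lemma ord0_vlift T : ord0 \notin vlift T.
Proof. by apply/imsetP=> -[i _ /eqP]; rewrite (negbTE (neq_lift _ _)). Qed.

Lemma vlift0 : vlift (set0 : {set 'I_n}) = set0.
Proof. exact: imset0. Qed.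

Lemma vliftU1 i T : vlift (i |: T) = lift ord0 i |: vlift T.
Proof. exact: imsetU1. Qed.

Lemma card_vlift T : #|vlift T| = #|T|.
Proof. by rewrite card_imset //; apply: lift_inj. Qed.

Lemma vlift_inj : injective (@vlift n).
Proof. by apply: imset_inj; apply: lift_inj. Qed.

Lemma dset_vliftU1 (R : realFieldType) i T (g : {mpoly R[n.+1]}) : i \notin T ->
  dset (vlift (i |: T)) g = dset (vlift T) g^`M(lift ord0 i).
Proof. by move=> iT; rewrite vliftU1 dsetU1 ?mem_vlift // dset_mderiv. Qed.

Lemma dset_vlift_split (R : realFieldType) S T (g : {mpoly R[n.+1]}) :
  dset (vlift T) g = dset (vlift (T :&: S)) (dset (vlift (T :\: S)) g).
Proof.
rewrite (dset_split (vlift S)); congr (dset _ (dset _ _)).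
  by rewrite /vlift imsetI // => ? ? _ _ /lift_inj.
by apply/setP=> i; rewrite inE; have [j ->|->] := unliftP ord0 i;
  rewrite ?mem_vlift ?inE ?mem_vlift // ?(negbTE (ord0_vlift _)) ?andbF.
Qed.

End Lifts.

(** * Square-free derivatives acting on Taylor coefficients *)

Section TaylorFaces.
Variables (R : realFieldType) (n : nat) (S : {set 'I_n}) (c : 'I_n -> R).
Implicit Types (f h : {mpoly R[n]}) (g : {mpoly R[n.+1]}) (T A : {set 'I_n}).

Lemma dset_ord0 T g : dset (ord0 |: vlift T) g = dset (vlift T) g^`M(ord0).
Proof. by rewrite dsetU1 ?ord0_vlift // dset_mderiv. Qed.

Lemma dset_plift T f : dset (vlift T) (plift f) = plift (dset T f).
Proof.
elim/finset_ind: T f => [|i T iT IHT] f; first by rewrite vlift0 !dset0.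
by rewrite dset_vliftU1 // dsetU1 // mderiv_plift IHT dset_mderiv.
Qed.

Lemma bus_dset T g : g^`M(ord0) = 0 ->
  bus S c (dset (vlift T) g) = dset T (bus S c g).
Proof. by move=> /(plift_bus S c) {1}<-; rewrite dset_plift bus_plift. Qed.

Lemma tay_dset_disjoint T k g : [disjoint T & S] ->
  tay S c k (dset (vlift T) g) = dset T (tay S c k g).
Proof.
elim/finset_ind: T g => [|i T iT IHT] g; first by rewrite vlift0 !dset0.
rewrite -setI_eq0 setIUl setU_eq0 !setI_eq0 disjoints1 => /andP[iS dTS].
rewrite dset_vliftU1 // dsetU1 // IHT // tay_mderiv /sc (negbTE iS).
by rewrite scale0r subr0 dset_mderiv.
Qed.

Lemma tay_dsetD T k g :
  tay S c k (dset (vlift (T :\: S)) g) = dset (T :\: S) (tay S c k g).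
Proof.
by apply: tay_dset_disjoint; rewrite -setI_eq0 setIDAC -setIDA setDv setI0.
Qed.

(** Each operator [\partial_i - sc i E] moves the lowest order down by one and multiplies the lowest
    coefficient by [- sc i], since its first summand still meets only zeros there. *)
Lemma tay_dset_lowest A m g : (forall k, (k < m)%N -> tay S c k g = 0) ->
  (forall k, (k + #|A| < m)%N -> tay S c k (dset (vlift A) g) = 0) /\
  (forall k, (k + #|A|)%N = m ->
     tay S c k (dset (vlift A) g) = (\prod_(i in A) - sc S c i) *: tay S c m g).
Proof.
elim/finset_ind: A m g => [|i A iA IHA] m g gm.
  rewrite vlift0 dset0 big_set0 cards0; split=> k; rewrite addn0; first exact: gm.
  by move->; rewrite scale1r.
rewrite dset_vliftU1 // big_setU1 //= cardsU1 iA /=.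
(* For [m = 0] both claims are vacuous, the set being nonempty. *)
case: m gm => [|m] gm; first by split=> k; rewrite ?addnA ?addn1 //.
have [|IH1 IH2] := IHA m g^`M(lift ord0 i).
  move=> k ltkm; rewrite tay_mderiv (gm k.+1) // (gm k (leqW ltkm)).
  by rewrite mderiv0 scaler0 subr0.
split=> k; rewrite addnCA add1n; first by rewrite ltnS; apply: IH1.
case=> /IH2->; rewrite tay_mderiv (gm m) // mderiv0 sub0r -scaleNr scalerA.
by rewrite mulrC.
Qed.

Hypothesis c_neq0 : forall i, i \in S -> c i != 0.

(* In the notation of the header, the induction step is that [x_j - E] maps the
   sequence [h_{k - #|A| - 1}(x_{j |: A})] to [- h_{k - #|A|}(x_A)]. *)
Lemma dset_complete A f g : A \subset S ->
  (forall k, tay S c k g =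
     if (#|A| <= k)%N then hbar A c (k - #|A|) f else 0) ->
  dset (vlift A) g = (\prod_(i in A) - c i) *: plift f.
Proof.
elim/finset_ind: A g => [|j A jA IHA] g sAS gE.
  rewrite vlift0 dset0 big_set0 scale1r; apply/eqP; rewrite -subr_eq0.
  apply/eqP/(@tay_inj _ _ S c) => k; rewrite linearB /= gE tay_plift cards0 subn0.
  by case: k => [|k]; rewrite ?hbar0 ?hbar_set0 subrr.
have [jS {}sAS] : j \in S /\ A \subset S by move: sAS; rewrite subUset sub1set => /andP.
have cj := c_neq0 jS.
rewrite dset_vliftU1 // big_setU1 //= -scalerA.
rewrite -(IHA ((- c j)^-1 *: g^`M(lift ord0 j))) //.
  by rewrite [dset _ (_ *: _)]linearZ /= scalerA mulfV ?oppr_eq0 // scale1r.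
move=> k; rewrite linearZ /= tay_mderiv !gE /sc jS cardsU1 jA add1n.
rewrite invrN scaleNr -scalerN opprB scalerBr scalerA mulVf // scale1r.
have [ltAk|] := ltnP #|A| k.
  rewrite (ltnW ltAk) ltnS (ltnW ltAk) subSS subnS.
  have -> : (k - #|A|)%N = (k - #|A|).-1.+1 by rewrite prednK ?subn_gt0.
  by rewrite hbarU1 // addrK.
rewrite leq_eqVlt ltnS => /predU1P[->|ltkA].
  by rewrite leqnn subSS subnn 2!hbar0 mderiv0 scaler0 subr0.
by rewrite leqNgt ltkA /= mderiv0 scaler0 subr0.
Qed.

(** Apply [dset_complete] with [A = S] to the correction term [g]. The factors [- c_i], the inverses
    of the [c_i] and the sign [(-1)^s] cancel, so the correction contributes exactly the lift of
    [\partial^S f]. *)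
Lemma dset_subdiv f : dset (vlift S) (subdiv S c f) = 0.
Proof.
pose g := (-1) ^+ #|S| *: (plift f - subdiv S c f).
have gE k : tay S c k g =
    if (#|S| <= k)%N then hbar S c (k - #|S|) (dbar c (mesym1 S) f) else 0.
  rewrite /g linearZ /= linearB /= tay_subdiv tay_plift opprB addrC subrK.
  by rewrite scalerA -expr2 sqrr_sign scale1r.
have subE : subdiv S c f = plift f - (-1) ^+ #|S| *: g.
  by rewrite /g scalerA -expr2 sqrr_sign scale1r subKr.
rewrite subE [LHS]linearB /= -/(dset _ _) dset_plift linearZ /= -/(dset _ g).
rewrite (dset_complete (subxx S) gE) dbar_mesym1 scalerA prodrN mulrA.
rewrite -expr2 sqrr_sign mul1r [plift (_ *: _)]linearZ /= scalerA -big_split /=.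
rewrite big1 ?scale1r ?subrr //.
by move=> i /c_neq0 ci; rewrite mulfV.
Qed.

End TaylorFaces.

(** * Faces of the stellar subdivision *)

Lemma vlift_cases n (F : {set 'I_n.+1}) :
  exists T, F = vlift T \/ F = ord0 |: vlift T.
Proof.
exists [set i | lift ord0 i \in F].
have [F0|F0] := boolP (ord0 \in F); [right|left]; apply/setP=> i.
  by have [j ->|->] := unliftP ord0 i; rewrite !inE ?mem_vlift ?inE // F0.
have [j ->|->] := unliftP ord0 i; first by rewrite mem_vlift inE.
by rewrite (negbTE F0) (negbTE (ord0_vlift _)).
Qed.

Section Stellar.
Variables (n : nat) (D : {set {set 'I_n}}) (S : {set 'I_n}).
Implicit Types T : {set 'I_n}.

Lemma mem_stellar_vlift T :
  (vlift T \in stellar D S) = (T \in D) && ~~ (S \subset T).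
Proof.
rewrite inE mem_imset ?inE; last exact: vlift_inj.
case: imsetP => [[T' _ eqT]|_]; last by rewrite orbF.
by have := ord0_vlift T; rewrite eqT setU11.
Qed.

Lemma mem_stellar_ord0 T :
  (ord0 |: vlift T \in stellar D S) = ~~ (S \subset T) && (T :|: S \in D).
Proof.
have inj_cone : injective (fun T => ord0 |: vlift T).
  move=> T1 T2 /setP eqT; apply/setP=> i.
  by have := eqT (lift ord0 i); rewrite !inE /= !mem_vlift.
pose C := [set T : {set 'I_n} | ~~ (S \subset T) & T :|: S \in D].
rewrite inE; have /= -> := mem_imset C T inj_cone; rewrite [T \in C]inE.
case: imsetP => [[T' _ eqT]|_] //=.
by have := ord0_vlift T'; rewrite -eqT setU11.
Qed.

End Stellar.

(** * Lineality and homogeneity under [bus], [plift] and [subdiv] *)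

Section Spaces.
Variables (R : realFieldType) (n d : nat).
Variables (D : {set {set 'I_n}}) (L : {pred 'rV[R]_n}).
Variables (S : {set 'I_n}) (c : 'I_n -> R).
Implicit Types (f h : {mpoly R[n]}) (g : {mpoly R[n.+1]}) (T A F : {set 'I_n}).

Lemma dset_eq0_notin (m : nat) (E : {set {set 'I_m}}) (p : {mpoly R[m]})
    (T : {set 'I_m}) :
  complex_of p \subset E -> T \notin E -> dset T p = 0.
Proof.
by move=> pE TE; apply/eqP; apply: contraNT TE => pT; apply: (subsetP pE); rewrite inE.
Qed.

Lemma Ddir_is_linear (m : nat) (u : 'rV[R]_m) : linear (Ddir u).
Proof.
move=> a p q; rewrite /Ddir scaler_sumr -big_split; apply: eq_bigr => i _ /=.
by rewrite linearP scalerDr !scalerA mulrC.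
Qed.

HB.instance Definition _ (m : nat) (u : 'rV[R]_m) :=
  GRing.isLinear.Build R {mpoly R[m]} {mpoly R[m]} _ (Ddir u) (Ddir_is_linear u).

Lemma sum_sc (x : 'I_n -> R) : \sum_i x i * sc S c i = \sum_(i in S) c i * x i.
Proof.
rewrite [RHS]big_mkcond; apply: eq_bigr => i _.
by rewrite /sc; case: ifP; rewrite ?mulr0 // mulrC.
Qed.

(** The shift enters with total coefficient [l_0] minus the sum of the [c_i l_i], which is zero by
    the equation defining [Lc]. *)
Lemma tay_Ddir k (l : 'rV[R]_n.+1) g :
  l 0 ord0 = \sum_(i in S) c i * l 0 (lift ord0 i) ->
  tay S c k (Ddir l g) = Ddir (\row_i l 0 (lift ord0 i)) (tay S c k g).
Proof.
move=> l0; rewrite /Ddir big_ord_recl linearD /= linearZ /= tay_mderiv0.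
rewrite (linear_sum (tay S c k)) l0 -sum_sc scaler_suml -big_split.
apply: eq_bigr => i _ /=; rewrite linearZ /= tay_mderiv mxE scalerBr scalerA.
by rewrite addrC subrK.
Qed.

Lemma Lc_lift (u : 'rV[R]_n) : u \in L ->
  exists2 l, l \in Lc L S c & \row_i l 0 (lift ord0 i) = u.
Proof.
move=> uL; pose l : 'rV[R]_n.+1 := \row_j
  if unlift ord0 j is Some i then u 0 i else \sum_(i in S) c i * u 0 i.
have lE i : l 0 (lift ord0 i) = u 0 i by rewrite mxE liftK.
have rowE : \row_i l 0 (lift ord0 i) = u by apply/rowP=> i; rewrite mxE lE.
exists l => //; rewrite inE /= rowE uL mxE unlift_none /=.
by apply/eqP; apply: eq_bigr => i _; rewrite lE.
Qed.

Lemma dhomog_bus g : g \is d.-homog -> bus S c g \is d.-homog.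
Proof.
have [lq [busE lq0 lqS]] := bus_comp S c; rewrite busE.
apply: dhomog_comp_mpoly => j; have [i ->|->] := unliftP ord0 j.
  by rewrite lqS dhomogX /= mdeg1.
by rewrite lq0 rpred_sum // => i _; rewrite rpredZ // dhomogX /= mdeg1.
Qed.

Lemma dhomog_plift f : f \is d.-homog -> plift f \is d.-homog.
Proof.
by apply: dhomog_comp_mpoly => j; rewrite tnth_mktuple dhomogX /= mdeg1.
Qed.

Lemma dhomog_dbar (m : 'X_{1..n}) f :
  f \is d.-homog -> dbar c m f \is (d - mdeg m).-homog.
Proof.
move=> hf; rewrite rpredZ //; have [lemd|ltdm] := leqP (mdeg m) d.
  by apply: dhomog_mderivm; rewrite subnK.
by rewrite (dhomog_mderivm_eq0 hf) ?dhomog0.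
Qed.

Lemma dhomog_zvar : zvar S c \is 1.-homog.
Proof.
rewrite rpredB ?rpred_sum // => [|i _]; last by rewrite rpredZ // dhomogX /= mdeg1.
by rewrite dhomogX /= mdeg1.
Qed.
End Spaces.

Lemma dhomog_subdiv (R : realFieldType) (n d : nat) (S : {set 'I_n}) (c : 'I_n -> R)
    (f : {mpoly R[n]}) : f \is d.-homog -> subdiv S c f \is d.-homog.
Proof.
move=> hf; rewrite rpredB ?dhomog_plift // rpredZ // big_nat rpred_sum // => k.
case/andP=> leSk _; rewrite rpredZ //; set h := hbar _ _ _ _.
have hh : h \is (d - k).-homog.
  rewrite rpred_sum // => m /andP[/eqP dm _]; rewrite -dbarD.
  have -> : (d - k = d - mdeg (mesym1 S + m)%MM)%N.
    by rewrite mdegD mdeg_mesym1 dm subnKC.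
  exact: dhomog_dbar.
have [lekd|ltdk] := leqP k d.
  rewrite -(subnKC lekd); apply: dhomogM; last exact: dhomog_plift.
  by have := dhomogMn k (dhomog_zvar S c); rewrite mul1n.
(* For [k > d] the degree [d - k] is truncated to 0 and says nothing; instead [h] vanishes, being
   obtained from [f] by operators of order [k]. *)
have -> : h = 0; last by rewrite [plift 0]linear0 mulr0 dhomog0.
rewrite /h /hbar big1 // => m /andP[/eqP dm _]; rewrite -dbarD /dbar.
rewrite (dhomog_mderivm_eq0 hf) ?scaler0 //.
by rewrite mdegD mdeg_mesym1 dm subnKC.
Qed.

(** * The maps [bus] and [subdiv] between the two spaces *)

Section Main.
Variables (R : realFieldType) (n d : nat).
Variables (D : {set {set 'I_n}}) (L : {pred 'rV[R]_n}).
Variables (S : {set 'I_n}) (c : 'I_n -> R).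
Implicit Types (f h : {mpoly R[n]}) (g : {mpoly R[n.+1]}) (T A F : {set 'I_n}).
Hypotheses (hD : simplicial_complex D) (hdim : cdim D = d) (hDL : hereditary D L).
Hypotheses (hS : S \in D) (hs : (1 <= #|S|)%N) (hc : forall i, i \in S -> 0 < c i).

Let P := Pspace d D L.
Let P' := Pspace d (stellar D S) (Lc L S c).

Let c_neq0 i : i \in S -> c i != 0.
Proof. by move/hc/lt0r_neq0. Qed.

Lemma bus_subdiv f : bus S c (subdiv S c f) = f.
Proof.
by rewrite -tay0 tay_subdiv /= leqNgt hs /= scaler0 subr0.
Qed.

Lemma notin_setU T : T \notin D -> T :|: S \notin D.
Proof. by apply: contraNN => TS; apply: hD TS _; apply: subsetUl. Qed.

Lemma setD_setU T : T :\: S :|: S = T :|: S.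
Proof. by apply/setP=> i; rewrite !inE; case: (i \in S); rewrite ?orbT ?orbF. Qed.

Lemma dset_setU f T : dset (T :|: S) f = dset S (dset (T :\: S) f).
Proof.
rewrite -setD_setU dset_disjointU // -setI_eq0.
by apply/eqP/setP=> i; rewrite !inE; case: (i \in S); rewrite ?andbF.
Qed.

(** Every Taylor coefficient of positive order of [subdiv S c f] is zero or an operator applied to
    [\partial^S f]; the derivative along [T :\: S] turns this into an operator applied to
    [\partial^(T :|: S) f = 0]. *)
Lemma mderiv0_dsetD_subdiv f T : dset (T :|: S) f = 0 ->
  (dset (vlift (T :\: S)) (subdiv S c f))^`M(ord0) = 0.
Proof.
move=> fTS; apply: (@tay_inj _ _ S c) => k; rewrite tay_mderiv0 tay_dsetD.
rewrite tay_subdiv /= sub0r -scaleNr [dset _ _]linearZ /=.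
case: ifP => _; last by rewrite linear0 scaler0.
by rewrite mderivm_hbar mderivm_dbar dbar_mesym1 -dset_setU fTS scaler0 linear0 scaler0.
Qed.

Lemma subdiv_Pspace f : P f -> P' (subdiv S c f).
Proof.
case=> hf Lf Df; split; first exact: dhomog_subdiv.
- move=> l; rewrite inE => /andP[uL /eqP l0]; rewrite inE /=; apply/eqP.
  apply: (@tay_inj _ _ S c) => k; rewrite (tay_Ddir _ _ l0).
  have /eqP fu := Lf _ uL; rewrite tay_subdiv linearB /= linearZ /=.
  have -> : Ddir (\row_i l 0 (lift ord0 i)) (if k == 0%N then f else 0) = 0.
    by case: ifP => _; rewrite ?fu ?linear0.
  case: ifP => _; last by rewrite linear0 scaler0 subr0.
  by rewrite Ddir_hbar dbar_mesym1 [Ddir _ (_ *: _)]linearZ /= Ddir_dset fu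
    [dset _ 0]linear0 scaler0 linear0 scaler0 subr0.
apply/subsetP=> F; rewrite inE; apply: contraNT.
have gS T : S \subset T -> dset (vlift T) (subdiv S c f) = 0.
  move=> sST; rewrite (dset_sub _ (imsetS _ sST : vlift S \subset vlift T)).
  by rewrite dset_subdiv // [dset _ 0]linear0.
have fN T : T \notin D -> dset T f = 0 by apply: dset_eq0_notin.
have [T [->|->]] := vlift_cases F.
  rewrite mem_stellar_vlift negb_and negbK.
  have [TD /= /gS->//|TD _] := boolP (T \in D).
  (* The derivative along [T :\: S] is free of [t_0], so it is the lift of the same derivative of
     [f]; differentiating along [T :&: S] then yields the lift of [dset T f], which is zero. *)
  have w0 := mderiv0_dsetD_subdiv (fN _ (notin_setU TD)).
  rewrite (dset_vlift_split S) -(plift_bus S c w0) dset_plift -tay0 tay_dsetD tay0.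
  by rewrite bus_subdiv -dset_split fN // [plift 0]linear0.
rewrite mem_stellar_ord0 negb_and negbK dset_ord0.
case/orP=> [/gS gT|TS]; first by rewrite dset_mderiv gT mderiv0.
rewrite (dset_vlift_split S) dset_mderiv.
by rewrite (mderiv0_dsetD_subdiv (fN _ TS)) [dset _ 0]linear0.
Qed.

Lemma mderiv0_dsetD g T : P' g -> T :|: S \notin D ->
  (dset (vlift (T :\: S)) g)^`M(ord0) = 0.
Proof.
case=> _ _ Dg TS; rewrite -dset_mderiv -dset_ord0; apply: dset_eq0_notin Dg _.
by rewrite mem_stellar_ord0 setD_setU (negbTE TS) andbF.
Qed.

Lemma tay_lineality k g : P' g -> {subset L <= lineality (tay S c k g)}.
Proof.
case=> _ Lg _ u uL; have [l lL <-] := Lc_lift S c uL.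
have /eqP gl := Lg l lL; move: lL; rewrite inE => /andP[_ /eqP l0].
by rewrite inE /= -(tay_Ddir _ _ l0) gl linear0.
Qed.

Lemma bus_Pspace g : P' g -> P (bus S c g).
Proof.
move=> Pg; have [hg Lg Dg] := Pg; split; first exact: dhomog_bus.
  by rewrite -tay0; apply: tay_lineality.
apply/subsetP=> T; rewrite inE; apply: contraNT => TD.
(* Once [t_0] is gone, [bus] commutes with the derivatives along [T :&: S], so [dset T (bus S c g)]
   is the image of a derivative of [g] at a non-face. *)
have w0 := mderiv0_dsetD Pg (notin_setU TD).
rewrite (dset_split S) -tay0 -tay_dsetD tay0 -bus_dset // -dset_vlift_split.
rewrite (dset_eq0_notin Dg) ?[bus _ _ 0]linear0 //.
by rewrite mem_stellar_vlift (negbTE TD).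
Qed.

(* Below order [#|S|] the Taylor coefficients live on the star of [S] in too
   high a degree; from order [#|S|] on, [dset (vlift S) g = 0] expresses each
   one through the previous ones. *)
Lemma bus_inj0 g : P' g -> bus S c g = 0 -> g = 0.
Proof.
move=> Pg g0; have [hg Lg Dg] := Pg; apply: (@tay_inj _ _ S c) => k.
have leSd : (#|S| <= d)%N.
  by rewrite -hdim; apply: (leq_bigmax_cond (F := fun T : {set 'I_n} => #|T|)).
elim/ltn_ind: k => k IHk; case: (posnP k) => [->|k0]; first by rewrite tay0.
have [leSk|ltkS] := leqP #|S| k.
  have [_ /(_ _ (subnK leSk))] := tay_dset_lowest S IHk.
  rewrite (dset_eq0_notin Dg) ?mem_stellar_vlift ?subxx ?andbF // linear0.
  move/esym/eqP; rewrite scaler_eq0 => /orP[/prodf_eq0[i iS]|/eqP //].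
  by rewrite /sc iS oppr_eq0 (negbTE (c_neq0 iS)).
have ltkd := leq_trans ltkS leSd.
apply: (star_dhomog_eq0 (S := S) (e := (d - k)%N) hDL).
- apply: dhomog_bus; apply: dhomog_mderivm.
  by rewrite mdegMn mdeg1 mul1n subnK // ltnW.
- exact: tay_lineality.
- move=> T; rewrite inE; apply: contraNT => TS.
  rewrite (dset_split S) -tay_dsetD -(prednK k0) -tay_mderiv0.
  by rewrite (mderiv0_dsetD Pg TS) linear0 [dset _ 0]linear0.
- rewrite hdim addnC addnBA ?(ltnW ltkd) // addnC -addnBA ?(ltnW ltkS) //.
  by rewrite -{1}(addn0 d) ltn_add2l subn_gt0.
Qed.

Lemma bus_inj g1 g2 : P' g1 -> P' g2 -> bus S c g1 = bus S c g2 -> g1 = g2.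
Proof.
move=> Pg1 Pg2 eqg; apply/eqP; rewrite -subr_eq0; apply/eqP/bus_inj0.
  by rewrite addrC -scaleN1r; apply: Pspace_linear.
by rewrite linearB /= eqg subrr.
Qed.

(** For a face containing 0, some [j] in [S] lies outside [T]; its free coordinate is used to adjust
    [l_0], while heredity is applied to [T :|: S]. *)
Lemma hereditary_stellar : hereditary (stellar D S) (Lc L S c).
Proof.
move=> F; have [T [->|->]] := vlift_cases F.
  rewrite mem_stellar_vlift => /andP[TD _] x.
  have [u uL uE] := hDL TD (fun i => x (lift ord0 i)).
  have [l lL lE] := Lc_lift S c uL; exists l => // _ /imsetP[i iT ->].
  by rewrite -uE // -lE mxE.
rewrite mem_stellar_ord0 => /andP[/subsetPn[j jS jT] TS] x.
(* The value at [j] is solved from the requirement that the sum of the [c_i y_i] over [S] be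
   [x ord0]; the rest of [S] off [T] is set to zero. *)
pose y i := if i \in T then x (lift ord0 i) else
  if i == j then (x ord0 - \sum_(i in S :&: T) c i * x (lift ord0 i)) / c j else 0.
have [u uL uE] := hDL TS y.
have [l lL lE] := Lc_lift S c uL; exists l => // i.
have lu i' : l 0 (lift ord0 i') = u 0 i' by rewrite -lE mxE.
rewrite in_setU1 => /predU1P[->|/imsetP[i' iT ->]]; last first.
  by rewrite lu uE ?inE ?iT // /y iT.
move: lL; rewrite inE => /andP[_ /eqP ->].
rewrite (eq_bigr (fun i => c i * y i)); last first.
  by move=> i' iS; rewrite lu uE // inE iS orbT.
rewrite (big_setID T) /= [X in _ + X](bigD1 j) ?inE ?jT //=.
rewrite [X in _ + (_ + X)]big1 ?addr0.
  rewrite {2}/y (negbTE jT) eqxx mulrC divfK ?c_neq0 // addrC.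
  rewrite -[RHS](subrK (\sum_(i in S :&: T) c i * x (lift ord0 i))).
  congr (_ + _); apply: eq_bigr => i'; rewrite inE => /andP[_ iT].
  by rewrite /y iT.
move=> i'; rewrite !inE => /andP[/andP[/negbTE iT _] /negbTE ij].
by rewrite /y iT ij mulr0.
Qed.

(** The truncation at [msize f] varies with [f], so linearity is not read off the formula; both
    sides lie in the space where [bus] is injective and have the same image. *)
Lemma subdiv_linear a f1 f2 : P f1 -> P f2 ->
  subdiv S c (a *: f1 + f2) = a *: subdiv S c f1 + subdiv S c f2.
Proof.
move=> Pf1 Pf2; apply: bus_inj.
- by apply: subdiv_Pspace; apply: Pspace_linear.
- by apply: Pspace_linear; apply: subdiv_Pspace.
- rewrite (bus_subdiv (a *: f1 + f2)); apply/esym.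
  apply: (etrans (linearP (bus S c) a _ _)).
  by congr (_ *: _ + _); apply: bus_subdiv.
Qed.

(** * Top-degree square-free coefficients of [subdiv] and positivity *)

Lemma tay_remainder k f :
  tay S c k (subdiv S c f - plift f) =
    - (-1) ^+ #|S| *:
      (if (#|S| <= k)%N then hbar S c (k - #|S|) (dbar c (mesym1 S) f) else 0).
Proof. by rewrite linearB /= tay_subdiv tay_plift addrC addKr scaleNr. Qed.

Lemma tay_dset_remainder k f T : (k < #|S|)%N ->
  tay S c k (dset (vlift (T :\: S)) (subdiv S c f - plift f)) = 0.
Proof.
by move=> ltkS; rewrite tay_dsetD tay_remainder leqNgt ltkS scaler0 [LHS]linear0.
Qed.

Lemma card_setI_lt T : ~~ (S \subset T) -> (#|T :&: S| < #|S|)%N.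
Proof.
move=> ST; apply: proper_card; rewrite properE subsetIr /=.
by apply: contraNN ST => /subset_trans; apply; apply: subsetIl.
Qed.

(** The remainder [subdiv S c f - plift f] starts at order [#|S|] in [z]. Fewer than [#|S|]
    derivatives along [S] leave a positive order, which [bus] kills. *)
Lemma mcoeff_subdiv_vlift f T :
  f \is d.-homog -> #|T| = d -> ~~ (S \subset T) ->
  (subdiv S c f)@_(mesym1 (vlift T)) = f@_(mesym1 T).
Proof.
move=> hf dT ST; apply/eqP; rewrite -(mpolyC_eq n) -(dset_top hf dT).
have cardg : #|vlift T| = d by rewrite card_vlift.
have <- : bus S c (dset (vlift T) (subdiv S c f)) =
    ((subdiv S c f)@_(mesym1 (vlift T)))%:MP.
  by rewrite (dset_top (dhomog_subdiv S c hf) cardg) /bus comp_mpolyC.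
rewrite -[subdiv S c f](subrK (plift f)) [dset _ (_ + _)]linearD /=.
rewrite -!/(dset _ _) [bus _ _ _]linearD /= dset_plift bus_plift (dset_vlift_split S).
have [lowest _] := tay_dset_lowest (T :&: S) (fun k => @tay_dset_remainder k f T).
by rewrite -tay0 lowest ?add0r // card_setI_lt.
Qed.

(** The derivative in [t_0] makes the remainder start at order [#|S| - 1], so only sets [T] missing
    a single element of [S] reach order 0, where the lowest coefficient comes from [h_0 = 1]. *)
Lemma mcoeff_subdiv_ord0 f T :
  f \is d.-homog -> #|T|.+1 = d -> ~~ (S \subset T) ->
  (subdiv S c f)@_(mesym1 (ord0 |: vlift T)) =
    if #|T :&: S|.+1 == #|S| then
      (\prod_(i in T :&: S) c i) * (\prod_(i in S) (c i)^-1) * f@_(mesym1 (T :|: S))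
    else 0.
Proof.
move=> hf dT ST; apply/eqP; rewrite -(mpolyC_eq n); apply/eqP.
have cardg : #|ord0 |: vlift T| = d by rewrite cardsU1 ord0_vlift card_vlift.
have <- : bus S c (dset (ord0 |: vlift T) (subdiv S c f)) =
    ((subdiv S c f)@_(mesym1 (ord0 |: vlift T)))%:MP.
  by rewrite (dset_top (dhomog_subdiv S c hf) cardg) /bus comp_mpolyC.
pose r := subdiv S c f - plift f.
have -> : dset (ord0 |: vlift T) (subdiv S c f) =
    dset (vlift (T :&: S)) (dset (vlift (T :\: S)) r)^`M(ord0).
  rewrite dset_ord0 (dset_vlift_split S) -(dset_mderiv ord0 (vlift _) r).
  by rewrite /r mderivB mderiv0_plift subr0.
set w := _^`M(ord0).
have w0 k : (k < #|S|.-1)%N -> tay S c k w = 0.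
  by move=> ltkS; rewrite tay_mderiv0 tay_dset_remainder // -ltn_predRL.
have [lo0 lo1] := tay_dset_lowest (T :&: S) w0.
have ltS := card_setI_lt ST; rewrite -tay0.
case: eqP => [eqS|neS]; last first.
  rewrite lo0 ?mpolyC0 // add0n ltn_predRL ltn_neqAle ltS andbT.
  exact/eqP.
rewrite lo1; last by rewrite -eqS.
rewrite tay_mderiv0 tay_dsetD (prednK hs).
rewrite tay_remainder leqnn subnn hbar0 dbar_mesym1 [dset _ _]linearZ /=.
rewrite [(_ *: dset S f)^`M[_]]linearZ /= -/(dset _ (dset _ _)) dset_comm -dset_setU.
rewrite (dset_top hf) ?scalerA; last first.
  apply/eqP; rewrite -(eqn_add2r #|T :&: S|) cardsUI -eqS -dT.
  by rewrite addnS addSn.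
rewrite -mul_mpolyC -mpolyCM; congr (_%:MP); congr (_ * _).
(* The sign [(-1)^(s-1)] from the factors [- c_i] cancels the sign [-(-1)^s] of the remainder. *)
rewrite prodrN -eqS exprS mulN1r opprK !mulrA; congr (_ * _).
rewrite mulrAC -expr2 sqrr_sign mul1r; apply: eq_bigr => i.
by rewrite inE /sc => /andP[_ ->].
Qed.

Lemma positive_subdiv f : P f -> positive f <-> positive (subdiv S c f).
Proof.
move=> Pf; have [hf Lf Df] := Pf; have [hg Lg Dg] := subdiv_Pspace Pf.
rewrite (positiveP hf (hereditary_sub Df Lf hDL)).
rewrite (positiveP hg (hereditary_sub Dg Lg hereditary_stellar)).
split=> [pos F dF|pos T dT].
  have [FD|FD] := boolP (F \in stellar D S); last first.
    have /eqP := dset_eq0_notin Dg FD; rewrite (dset_top hg dF) mpolyC_eq0.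
    by move/eqP->.
  have [T [FT|FT]] := vlift_cases F; move: FD dF; rewrite {}FT.
    rewrite mem_stellar_vlift card_vlift => /andP[_ ST] dT.
    by rewrite mcoeff_subdiv_vlift // pos.
  rewrite mem_stellar_ord0 cardsU1 ord0_vlift card_vlift => /andP[ST TS] dT.
  rewrite mcoeff_subdiv_ord0 //; case: eqP => // eqS.
  rewrite mulr_ge0 ?pos //.
    rewrite mulr_ge0 ?prodr_ge0 // => i; last by rewrite invr_ge0 => /hc/ltW.
    by rewrite inE => /andP[_ /hc/ltW].
  apply/eqP; rewrite -(eqn_add2r #|T :&: S|) cardsUI -eqS -dT.
  by rewrite addnS addSn.
have [sST|ST] := boolP (S \subset T); last first.
  by rewrite -(mcoeff_subdiv_vlift hf dT ST) pos // card_vlift.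
(* For [T] containing [S], the coefficient of [f] at [T] is recovered, up to a positive factor, from
   the face that replaces any [j] of [S] by the new vertex. *)
have /card_gt0P[j jS] : (0 < #|S|)%N := hs.
have jT := subsetP sST j jS.
have dTj : #|T :\ j|.+1 = d by rewrite -dT (cardsD1 j T) jT.
have STj : ~~ (S \subset T :\ j).
  by apply/subsetPn; exists j; rewrite ?setD11.
have := pos (ord0 |: vlift (T :\ j)).
rewrite cardsU1 ord0_vlift card_vlift => /(_ dTj).
rewrite mcoeff_subdiv_ord0 // setIDAC (setIidPr sST).
have -> : #|S :\ j|.+1 == #|S| by rewrite (cardsD1 j S) jS.
have -> : T :\ j :|: S = T.
  apply/setP=> i; rewrite !inE; have [->|_] := eqVneq i j; first by rewrite jS jT.
  by case: (boolP (i \in S)) => [/(subsetP sST) ->|_]; rewrite ?orbF.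
rewrite pmulr_rge0 // mulr_gt0 ?prodr_gt0 // => i; last by rewrite invr_gt0 => /hc.
by rewrite inE => /andP[_ /hc].
Qed.

End Main.

Theorem theorem5p4 (R : realType) (n d : nat)
    (D : {set {set 'I_n}}) (L : {vspace 'rV[R]_n})
    (S : {set 'I_n}) (c : 'I_n -> R)
    (hD : simplicial_complex D) (hdim : cdim D = d)
    (hDL : hereditary D L)
    (hS : S \in D) (hs : (1 <= #|S|)%N)
    (hc : forall i, i \in S -> 0 < c i) :
  let P := Pspace d D L in
  let P' := Pspace d (stellar D S) (Lc L S c) in
  [/\ forall g, P' g -> P (bus S c g),
      forall f, P f -> exists! g, P' g /\ bus S c g = f,
      [/\ forall f, P f -> P' (subdiv S c f),
          forall g, P' g -> subdiv S c (bus S c g) = g,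
          forall f, P f -> bus S c (subdiv S c f) = f &
          forall (a : R) f1 f2, P f1 -> P f2 ->
            subdiv S c (a *: f1 + f2) = a *: subdiv S c f1 + subdiv S c f2] &
      forall f, P f -> (positive f <-> positive (subdiv S c f))].
Proof.
move=> P P'.
have busP g : P' g -> P (bus S c g) by apply: bus_Pspace.
have subP f : P f -> P' (subdiv S c f) by apply: subdiv_Pspace.
have busK f : bus S c (subdiv S c f) = f by apply: bus_subdiv.
have inj g1 g2 : P' g1 -> P' g2 -> bus S c g1 = bus S c g2 -> g1 = g2.
  exact: bus_inj.
split=> [//|f Pf||f Pf]; last exact: positive_subdiv Pf.
  exists (subdiv S c f); split=> [|g [Pg gf]]; first by split; [apply: subP|].
  by apply: inj; rewrite ?busK //; apply: subP.
split=> // [g Pg|a f1 f2]; last exact: subdiv_linear.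
by apply: inj; rewrite ?busK //; apply/subP/busP.
Qed.
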